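(* Let $\mathbb{H}=\{a^r b^s : 0\le r\le 3,\ 0\le s\le 1\}$ be the quaternion group of order $8$ with identity $e$, and let $R=\mathbb{Z}_2[\mathbb{H}]$. All spans and bases below are over $\mathbb{Z}_2$. (1) For each of the subgroups $H=\mathbb{H},\langle a\rangle,\langle b\rangle,\langle ab\rangle,\langle a^2\rangle$, the set $I(H)$ of elements of $R$ of the form $\sum_{h\in H}x_h(h-e)$, $x_h\in R$, is a bilateral (two-sided) ideal of $R$. (2) The smallest ideal of $R$ is the two-element ideal $N=\{0,\ e+a+a^2+a^3+b+ab+a^2b+a^3b\}$. (3) The sets $$I_a=\{\lambda_1(e+a)^3+\lambda_2(e+a)^3b\},\quad I_b=\{\lambda_1(e+b)^3+\lambda_2(e+b)^3a\},\quad I_{ab}=\{\lambda_1(e+ab)^3+\lambda_2(e+ab)^3a\}\qquad(\lambda_i\in\mathbb{Z}_2)$$ are ideals of $R$. Combining the bases of $I_a$ and $I_b$ and deleting linearly dependent elements gives the basis $(e+a)^3,\ (e+a)^3b,\ (e+b)^3$ of an ideal $I_{a\oplus b}$ containing both $I_a$ and $I_b$. If $I_{a\oplus ab}$ and $I_{b\oplus ab}$ are obtained in the same way from the pairs $I_a,I_{ab}$ and $I_b,I_{ab}$, then $I_{a\oplus b}=I_{a\oplus ab}=I_{b\oplus ab}$. (4) The sets $$\{(e+a)(e+a),\ (e+a)^2a,\ (e+b)^2b,\ (e+b)^2ab\},$$ $$\{(e+a)(e+b),\ (e+a)(e+b)a,\ (e+a)(e+b)b,\ (e+a)(e+b)ab\},$$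 $$\{(e+a)(e+ab),\ (e+a)(e+ab)a,\ (e+a)(e+ab)b,\ (e+a)(e+ab)ab\}$$ are bases of ideals, denoted $M_a$, $M_b$, $M_{ab}$ respectively, each of which contains $I_{a\oplus b}$. Combining the bases of $M_a$ and $M_b$ and deleting linearly dependent elements gives the basis $$\{(e+a)^2,\ (e+a)^2a,\ (e+b)^2b,\ (e+b)^2ab,\ (e+a)(e+b)\}$$ of an ideal $M_{a\oplus b}$. If $M_{a\oplus ab}$ and $M_{b\oplus ab}$ are obtained in the same way from the pairs $M_a,M_{ab}$ and $M_b,M_{ab}$, then $M_{a\oplus b}=M_{a\oplus ab}=M_{b\oplus ab}$. (5) The ideals described in (1)–(4) are all the ideals of $R$.
   Context: The quaternion group is generated by $a=i$, $b=j$ with $a^4=b^4=e$, $a^2=b^2$, $aba=b$ (so $a^2=-e$, $ab=k$). $\mathbb{Z}_2$ is the field with two elements and $\mathbb{Z}_2[\mathbb{H}]$ is the group ring. All subgroups of $\mathbb{H}$ are normal.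
   Formalization: In (4) the fourth basis element (e+a)(e+ab)ab of M_ab is replaced by (e+a)(e+ab)ba, since the four printed elements sum to 0 and are not a basis. ''Ideal'' means two-sided; ''smallest'' means smallest nonzero; ''all the ideals'' means all except {0} and R. *)

(* Defs.v *)
From HB Require Import structures.
From mathcomp Require Import all_boot all_fingroup all_algebra all_solvable.

Set Implicit Arguments.
Unset Strict Implicit.
Unset Printing Implicit Defensive.

Import GRing.Theory.
Local Open Scope ring_scope.

(* F[G] for a finite group G: functions G -> F, with pointwise addition and
   scaling; the product below is convolution. *)
Definition groupRing (F : finFieldType) (G : finGroupType) : Type :=
  {ffun G -> F^o}.

Section GroupRing.
Variables (F : finFieldType) (G : finGroupType).

HB.instance Definition _ := Finite.copy (groupRing F G) {ffun G -> F}.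
HB.instance Definition _ := Vector.copy (groupRing F G) {ffun G -> F^o}.

Definition groupRing_elt (g : G) : groupRing F G := [ffun x => (x == g)%:R].

Definition groupRing_mul (u v : groupRing F G) : groupRing F G :=
  [ffun x => \sum_(y : G) (u y : F) * (v (y^-1 * x)%g : F)].

Lemma groupRing_mulA : associative groupRing_mul.
Proof.
move=> u v w; apply/ffunP => x; rewrite !ffunE.
under [RHS]eq_bigr => y _ do rewrite ffunE big_distrl /=.
rewrite [RHS]exchange_big /=; apply: eq_bigr => y _.
rewrite [RHS](reindex_inj (mulgI y)) ffunE big_distrr /=; apply: eq_bigr => z _.
by rewrite mulKg invMg mulrA mulgA.
Qed.

Lemma groupRing_mul1l : left_id (groupRing_elt 1%g) groupRing_mul.
Proof.
move=> u; apply/ffunP => x; rewrite ffunE (bigD1 1%g) //= ffunE eqxx mul1r.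
rewrite invg1 mul1g big1 ?addr0 // => y ny1.
by rewrite ffunE (negPf ny1) mul0r.
Qed.

Lemma groupRing_mul1r : right_id (groupRing_elt 1%g) groupRing_mul.
Proof.
move=> u; apply/ffunP => x; rewrite ffunE (bigD1 x) //= ffunE mulVg eqxx mulr1.
rewrite big1 ?addr0 // => y nyx; rewrite ffunE.
by rewrite -eq_invg_mul invgK (negPf nyx) mulr0.
Qed.

Lemma groupRing_mulDl : left_distributive groupRing_mul +%R.
Proof.
move=> u v w; apply/ffunP => x; rewrite !ffunE -big_split /=.
by apply: eq_bigr => y _; rewrite ffunE mulrDl.
Qed.

Lemma groupRing_mulDr : right_distributive groupRing_mul +%R.
Proof.
move=> u v w; apply/ffunP => x; rewrite !ffunE -big_split /=.
by apply: eq_bigr => y _; rewrite ffunE mulrDr.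
Qed.

Lemma groupRing_oner_neq0 : groupRing_elt 1%g != 0.
Proof.
by apply/eqP => /ffunP/(_ 1%g)/eqP; rewrite !ffunE eqxx oner_eq0.
Qed.

HB.instance Definition _ := GRing.Zmodule_isNzRing.Build (groupRing F G)
  groupRing_mulA groupRing_mul1l groupRing_mul1r
  groupRing_mulDl groupRing_mulDr groupRing_oner_neq0.

Lemma groupRing_scaleAl (c : F) (u v : groupRing F G) : c *: (u * v) = c *: u * v.
Proof.
apply/ffunP => x; rewrite !ffunE scaler_sumr.
by apply: eq_bigr => y _; rewrite ffunE; exact: mulrA.
Qed.

HB.instance Definition _ :=
  GRing.Lmodule_isLalgebra.Build F (groupRing F G) groupRing_scaleAl.

Lemma groupRing_scaleAr (c : F) (u v : groupRing F G) : c *: (u * v) = u * (c *: v).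
Proof.
apply/ffunP => x; rewrite !ffunE scaler_sumr.
by apply: eq_bigr => y _; rewrite ffunE; exact: mulrCA.
Qed.

HB.instance Definition _ :=
  GRing.Lalgebra_isAlgebra.Build F (groupRing F G) groupRing_scaleAr.

End GroupRing.

Definition quaternion_generators (G : finGroupType) (a b : G) : Prop :=
  [/\ [set: G] \isog 'Q_8, [set: G] = <<[set a; b]>>%g,
      (a ^+ 4 = 1)%g /\ (b ^+ 4 = 1)%g, (a ^+ 2 = b ^+ 2)%g
    & (a * b * a = b)%g].

Lemma quaternion_generators_exist :
  exists (G : finGroupType) (a b : G), quaternion_generators a b.
Proof.
have := isog_refl 'Q_8; case/(isoGrpP _ (@Grp_quaternion 3 isT)) => _.
case/existsP=> -[x y] /= /eqP[defG x4 y2 xy].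
exists 'Q_8, x, y; split=> //.
- exact: isog_refl.
- by rewrite -defG joing_idl joing_idr.
- by split=> //; rewrite (expgM y 2 2) y2 -expgM.
by rewrite [(x * y)%g]conjgC xy mulgKV.
Qed.

Definition two_sided_ideal (R : finNzRingType) (I : {set R}) : Prop :=
  [/\ 0 \in I,
      {in I &, forall x y, x - y \in I},
      {in I, forall x r, r * x \in I}
    & {in I, forall x r, x * r \in I}].

Definition nontrivial_ideal (R : finNzRingType) (I : {set R}) : Prop :=
  [/\ two_sided_ideal I, I != [set 0] & I != [set: R]].

Section IdealsOfGroupRings.
Variables (F : finFieldType) (G : finGroupType).
Implicit Types (H : {set G}) (s : seq (groupRing F G)) (I : {set groupRing F G}).

Definition relative_augmentation H : {set groupRing F G} :=
  [set \sum_(h in H) x h * (groupRing_elt F h - 1)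
     | x : {ffun G -> groupRing F G}].

Definition spanned s : {set groupRing F G} := [set x | x \in <<s>>%VS].

Definition ideal_basis s I : Prop :=
  [/\ free s, I = spanned s & two_sided_ideal I].

(* The list is scanned from left to right; an element is deleted when it
   depends linearly on those kept before it. *)
Definition delete_dependent s : seq (groupRing F G) :=
  foldl (fun t x => if x \in <<t>>%VS then t else rcons t x) [::] s.

Definition combine_bases s t : seq (groupRing F G) := delete_dependent (s ++ t).

End IdealsOfGroupRings.

(* Main.v *)
(** An element of [F_2[Q_8]] is coded by a number below 256 whose bit [r + 4 s]
    is the coefficient of [a^r b^s]. Addition becomes bitwise exclusive or, and
    membership in a span is decidable by computation on codes.

    The classification rests on two finite facts: the right ideal [xR] of every
    element [x] occurs in the list formed by [0], [R] and the ideals of (1)-(4),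
    and this list is closed under sums. An ideal is the sum of the [xR] with [x]
    in it, hence occurs in the list as well. *)

From Stdlib Require Import NArith.
Require Import Defs.
From mathcomp Require Import all_boot all_fingroup all_algebra all_solvable.
Set Implicit Arguments.
Unset Strict Implicit.
Unset Printing Implicit Defensive.

Import GRing.Theory.
Local Open Scope ring_scope.

(** * Linear algebra over the field with two elements *)

Lemma F2_cases (c : 'F_2) : c = 0 \/ c = 1.
Proof. by case: c => [[|[|//]] ?]; [left | right]; apply: val_inj. Qed.

Lemma F2_addrr (V : lmodType 'F_2) (x : V) : x + x = 0.
Proof.
rewrite -{1 2}[x]scale1r -scalerDl.
have -> : 1 + 1 = 0 :> 'F_2 by apply: val_inj.
by rewrite scale0r.
Qed.

Lemma F2_oppr (V : lmodType 'F_2) (x : V) : - x = x.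
Proof. by apply/eqP; rewrite eq_sym -addr_eq0 F2_addrr. Qed.

(** The coefficient of [v] is 0 or 1, and in characteristic 2 subtracting [v] is adding it. This
    recursion is the one that [in_span] runs on codes. *)
Lemma F2_mem_span_cons (vT : vectType 'F_2) (v x : vT) (s : seq vT) :
  (x \in <<v :: s>>%VS) = (x \in <<s>>%VS) || (v + x \in <<s>>%VS).
Proof.
rewrite span_cons.
apply/memv_addP/orP => [[u /vlineP[c ->] [w ws ->]] | [xs|vxs]].
- case: (F2_cases c) => ->; rewrite ?scale0r ?scale1r ?add0r; first by left.
  by right; rewrite addrA F2_addrr add0r.
- by exists 0; rewrite ?mem0v //; exists x; rewrite ?add0r.
exists v; rewrite ?memv_line //; exists (v + x) => //.
by rewrite addrA F2_addrr add0r.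
Qed.

(** With scalars 0 and 1 only, a span is the additive closure of its generators, so no clause for
    scaling appears. *)
Lemma F2_span_ind (vT : vectType 'F_2) (P : vT -> Prop) (s : seq vT) :
    P 0 -> (forall x y, P x -> P y -> P (x + y)) ->
    (forall v, v \in s -> P v) ->
  forall x, x \in <<s>>%VS -> P x.
Proof.
move=> P0 PD; elim: s => [|v s IHs] Ps x.
  by rewrite span_nil memv0 => /eqP->.
have Ps' w : w \in s -> P w by move=> ws; apply: Ps; rewrite inE ws orbT.
rewrite F2_mem_span_cons => /orP[/(IHs Ps')//|/(IHs Ps') Pvx].
rewrite -[x]add0r -(F2_addrr v) -addrA; apply: PD => //.
by apply: Ps; rewrite mem_head.
Qed.

(** * Products of group elements and spans in the group ring *)

Lemma groupRing_eltM (F : finFieldType) (G : finGroupType) (g h : G) :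
  groupRing_elt F g * groupRing_elt F h = groupRing_elt F (g * h)%g.
Proof.
apply/ffunP => x; rewrite !ffunE (bigD1 g) //= big1 => [|y /negPf ny].
  by rewrite !ffunE eqxx mul1r addr0 -(inj_eq (mulgI g)) mulKVg.
by rewrite ffunE ny mul0r.
Qed.

Lemma spannedE (F : finFieldType) (G : finGroupType)
    (s : seq (groupRing F G)) x : (x \in spanned s) = (x \in <<s>>%VS).
Proof. by rewrite inE. Qed.

Lemma subset_spanned (F : finFieldType) (G : finGroupType)
    (s t : seq (groupRing F G)) :
  (spanned s \subset spanned t) = (<<s>> <= <<t>>)%VS.
Proof.
by apply/subsetP/subvP => st x; move: (st x); rewrite !spannedE.
Qed.

(** Induction from the right end follows the left-to-right scan: a deleted element already lies in
    the span of those kept. *)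
Lemma span_delete_dependent (F : finFieldType) (G : finGroupType)
    (s : seq (groupRing F G)) : <<delete_dependent s>>%VS = <<s>>%VS.
Proof.
elim/last_ind: s => [//|s x IHs]; rewrite /delete_dependent foldl_rcons.
rewrite -/(delete_dependent s) -[rcons s x]cats1 span_cat IHs span_seq1.
have [xs|_] := boolP (x \in <<s>>%VS).
  by rewrite IHs; apply/esym/addv_idPl.
by rewrite -cats1 span_cat IHs span_seq1.
Qed.

Lemma F2_spanned2 (G : finGroupType) (u v : groupRing 'F_2 G) :
  [set l1 *: u + l2 *: v | l1 : 'F_2, l2 : 'F_2] = spanned [:: u; v].
Proof.
apply/setP => x; rewrite spannedE span_cons span_seq1.
apply/imset2P/memv_addP => [[c d _ _ ->]|].
  exists (c *: u); first by rewrite memvZ ?memv_line.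
  by exists (d *: v); rewrite ?memvZ ?memv_line.
by case=> _ /vlineP[c ->] [_ /vlineP[d ->] ->]; exists c d.
Qed.

Lemma F2_spanned1 (G : finGroupType) (u : groupRing 'F_2 G) :
  spanned [:: u] = [set 0; u].
Proof.
apply/setP => x; rewrite spannedE F2_mem_span_cons span_nil !memv0 !inE.
by rewrite addr_eq0 F2_oppr [u == x]eq_sym.
Qed.

Lemma F2_spanned_subset_ideal (G : finGroupType) (s : seq (groupRing 'F_2 G))
    (J : {set groupRing 'F_2 G}) :
  two_sided_ideal J -> {subset s <= J} -> spanned s \subset J.
Proof.
case=> J0 JB _ _ sJ; apply/subsetP => x; rewrite spannedE.
apply: (@F2_span_ind _ (fun x => x \in J)) => // y z Jy Jz.
by rewrite -[z]F2_oppr; apply: JB.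
Qed.

(** * Computation on codes *)

(** Only the eight low bits are read, so the zero test on codes is [nilp (bits n)] and every number
    is a legitimate code. *)
Definition bits (n : N) : seq nat :=
  [seq i <- iota 0 8 | N.testbit n (N.of_nat i)].

Definition unit_code (i : nat) : N := N.shiftl 1 (N.of_nat i).

(* The index of [a^r b^s] is [r + 4 s]; the formula encodes [b a = a^3 b] and
   [b^2 = a^2]. *)
Definition index_mul (i j : nat) : nat :=
  ((i %% 4 + (if (i < 4)%N then j %% 4 else 3 * (j %% 4))
    + (if (i < 4)%N || (j < 4)%N then 0 else 2)) %% 4
   + 4 * ((4 <= i)%N (+) (4 <= j)%N))%N.

Definition code_mul (m n : N) : N :=
  foldr N.lxor 0%num
    [seq unit_code (index_mul i j) | i <- bits m, j <- bits n].

(* [if] instead of [||]: [vm_compute] would evaluate both disjuncts. *)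
Fixpoint in_span (s : seq N) (n : N) : bool :=
  if s is v :: s' then
    if in_span s' n then true else in_span s' (N.lxor v n)
  else nilp (bits n).

Definition prune (s : seq N) : seq N :=
  foldl (fun t n => if in_span t n then t else rcons t n) [::] s.

Fixpoint independent (s : seq N) : bool :=
  if s is v :: s' then ~~ in_span s' v && independent s' else true.

(** The cost of [in_span] can double with each generator; pruning first leaves at most eight of
    them. *)
Definition code_subspan (s t : seq N) : bool :=
  let t' := prune t in all (in_span t') s.

(** By bilinearity, stability under multiplication by R on both sides is tested on generators and
    group elements. *)
Definition span_closed (s : seq N) : bool :=
  let s' := prune s in
  all (fun v => all (fun i => in_span s' (code_mul (unit_code i) v) &&
                              in_span s' (code_mul v (unit_code i)))
                    (iota 0 8)) s.

Definition unit_codes : seq N := map unit_code (iota 0 8).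

Fixpoint span_elements (s : seq N) : seq N :=
  if s is v :: s' then
    let t := span_elements s' in t ++ map (N.lxor v) t
  else [:: 0%num].

(** Codes of u(h - e) for group elements u; since -1 = 1, subtracting e flips bit 0. *)
Definition augmentation_codes (l : seq nat) : seq N :=
  [seq code_mul u (N.lxor (unit_code i) 1) | i <- l, u <- unit_codes].

Lemma index_mul_lt (i j : nat) : (index_mul i j < 8)%N.
Proof.
have add4 k (s : bool) : (k %% 4 + 4 * s < 8)%N.
  by case: s; rewrite ?muln1 ?muln0 ?addn0 ?(ltn_add2r 4 _ 4) ?ltn_pmod //;
    apply: ltn_trans (ltn_pmod k (isT : 0 < 4)%N) _.
by rewrite add4.
Qed.

(* In order: [I H] for the five subgroups, [N], [Ia], [Ib], [Iab], [Ia_b],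
   [Ma], [Mb], [Mab], [Ma_b]. *)
Definition proper_codes : seq (seq N) :=
  [:: [:: 3; 6; 12; 144; 48; 96; 17]; [:: 3; 6; 12; 144; 48; 96];
      [:: 17; 34; 68; 136; 20; 40]; [:: 33; 66; 132; 24; 18; 36];
      [:: 5; 10; 80; 160]; [:: 255]; [:: 15; 240]; [:: 85; 170];
      [:: 165; 90]; [:: 15; 240; 85]; [:: 5; 10; 80; 160];
      [:: 51; 150; 60; 102]; [:: 99; 54; 57; 147];
      [:: 5; 10; 80; 160; 51]]%num.

Definition all_codes : seq (seq N) := [:: [::], unit_codes & proper_codes].

(** * Finite checks by evaluation *)

Lemma proper_codes_closed : all span_closed proper_codes.
Proof. by vm_compute. Qed.

Lemma proper_codes_proper :
  all (fun s => ~~ code_subspan s [::] && ~~ code_subspan unit_codes s)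
      proper_codes.
Proof. by vm_compute. Qed.

(** The code 255 is the sum of all group elements, so this puts N inside every nonzero entry of the
    list. *)
Lemma all_codes_sum :
  all (fun s => nilp s || code_subspan [:: 255%num] s) all_codes.
Proof. by vm_compute. Qed.

(** The list [span_elements unit_codes] runs through all 256 elements x. The entry found contains x
    and lies in xR, which pins it down as xR because its span is an ideal. *)
Lemma all_codes_principal :
  all (fun n => has (fun s =>
         if in_span s n then code_subspan s (map (code_mul n) unit_codes)
         else false)
       all_codes) (span_elements unit_codes).
Proof. by vm_compute. Qed.

(** The entry [u] lies above both summands and inside their sum, hence spans that sum. *)
Lemma all_codes_add :
  all (fun s => all (fun t => has (fun u =>
         if code_subspan s u && code_subspan t u then code_subspan u (s ++ t)
         else false)
       all_codes) all_codes) all_codes.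
Proof. by vm_compute. Qed.

(** * The quaternion group through indices below 8 *)

Section Quaternion.
Variables (G : finGroupType) (ga gb : G).
Hypothesis hQ : quaternion_generators ga gb.

Definition quat (i : nat) : G := (ga ^+ (i %% 4) * gb ^+ (i %/ 4))%g.

Lemma quat_mod (r : nat) (s : bool) :
  quat (r %% 4 + 4 * s) = (ga ^+ r * gb ^+ s)%g.
Proof.
have [_ _ [a4 _] _ _] := hQ.
rewrite /quat addnC mulnC modnMDl modn_mod divnMDl //.
rewrite (divn_small (ltn_pmod _ _)) //.
by rewrite addn0 expg_mod.
Qed.

Lemma quat_expr (i : nat) : (i < 8)%N ->
  quat i = (ga ^+ i * gb ^+ (4 <= i)%N)%g.
Proof. by rewrite -quat_mod; do 8![case: i => [//|i]]. Qed.

(** Replacing b by aba in a^3 b gives a^4 ba = ba; iteration then carries b past each factor a,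
    turning it into a^3. *)
Lemma gb_expg_ga (r : nat) : (gb * ga ^+ r = ga ^+ (3 * r) * gb)%g.
Proof.
have [_ _ [a4 _] _ aba] := hQ.
have ba : (gb * ga = ga ^+ 3 * gb)%g.
  by rewrite -{2}aba !mulgA -expgSr a4 mul1g.
elim: r => [|r IHr]; first by rewrite muln0 !expg0 mulg1 mul1g.
by rewrite expgSr mulgA IHr -mulgA ba mulgA -expgD mulnSr.
Qed.

Lemma quatM (i j : nat) : (i < 8)%N -> (j < 8)%N ->
  (quat i * quat j)%g = quat (index_mul i j).
Proof.
have [_ _ [a4 _] a2 _] := hQ.
move=> i8 j8; rewrite /index_mul quat_mod !quat_expr //.
have E k : (ga ^+ k = ga ^+ (k %% 4))%g by rewrite expg_mod.
rewrite (E i) (E j) !(leqNgt 4).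
case: (i < 4)%N => /=; case: (j < 4)%N => /=;
  rewrite ?expg0 ?expg1 ?addn0 ?mulg1 ?mul1g.
- by rewrite expgD.
- by rewrite expgD mulgA.
- by rewrite -mulgA gb_expg_ga mulgA -expgD.
(* Both factors contain b: after b is moved past the power of a, b^2 = a^2 supplies the extra 2 in
   [index_mul]. *)
rewrite mulgA -(mulgA _ gb) gb_expg_ga mulgA -expgD -mulgA.
by rewrite -[(gb * gb)%g]/(gb ^+ 2)%g -a2 -expgD.
Qed.

(** The image of [quat] contains e and is closed under products by [quatM], so it is a subgroup; it
    contains the generators a (index 1) and b (index 4). *)
Lemma quat_onto x : exists2 i, (i < 8)%N & x = quat i.
Proof.
have [_ defG _ _ _] := hQ.
pose Q := [set quat (i : 'I_8) | i : 'I_8].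
have gQ : group_set Q.
  apply/group_setP; split.
    by apply/imsetP; exists ord0; rewrite //= /quat !expg0 mulg1.
  move=> _ _ /imsetP[i _ ->] /imsetP[j _ ->]; rewrite quatM //.
  by apply/imsetP; exists (Ordinal (index_mul_lt i j)).
have sub : (<<[set ga; gb]>> \subset Group gQ)%g.
  rewrite gen_subG; apply/subsetP=> y /set2P[]->; apply/imsetP.
    by exists (@Ordinal 8 1 isT); rewrite //= /quat expg0 mulg1 expg1.
  by exists (@Ordinal 8 4 isT); rewrite //= /quat expg0 mul1g expg1.
have : x \in [set: G] by rewrite inE.
by rewrite defG => /(subsetP sub) /imsetP[i _ ->]; exists i.
Qed.

(** A surjection from eight indices onto a group of order 8 is injective; the isomorphism with
    ['Q_8] supplies the order. *)
Lemma quat_inj : {in gtn 8 &, injective quat}.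
Proof.
have [isoG _ _ _ _] := hQ.
pose f (i : 'I_8) := quat i.
have cardG : #|G| = 8%N.
  by rewrite -cardsT (card_isog isoG) (@card_quaternion 3).
suff /imset_injP injf : #|f @: setT| == #|[set: 'I_8]|.
  move=> i j i8 j8 eq_ij.
  by have [] := injf (Ordinal i8) (Ordinal j8) (in_setT _) (in_setT _) eq_ij.
rewrite [X in _ == X]cardsT card_ord -[X in _ == X]cardG -cardsT.
apply/eqP/eq_card => x.
rewrite [RHS]in_setT; apply/imsetP; have [i i8 ->] := quat_onto x.
by exists (Ordinal i8).
Qed.

(** * Decoding numbers into ring elements *)

Local Notation R := (groupRing 'F_2 G).

Definition decode (n : N) : R :=
  \sum_(i <- bits n) groupRing_elt 'F_2 (quat i).

Lemma decode_quat (n : N) (i : nat) : (i < 8)%N ->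
  decode n (quat i) = (N.testbit n (N.of_nat i))%:R.
Proof.
move=> i8; rewrite /decode big_filter big_mkcond sum_ffunE.
have i_iota : i \in iota 0 8 by rewrite mem_iota.
rewrite (bigD1_seq _ i_iota (iota_uniq 0 8)) big_seq_cond big1 => [|j].
  by rewrite [LHS]addr0; case: N.testbit; rewrite ffunE ?eqxx.
rewrite mem_iota => /andP[j8 ij]; case: N.testbit; rewrite ffunE //.
by rewrite (inj_in_eq quat_inj) ?inE // eq_sym (negPf ij).
Qed.

Lemma decodeD (m n : N) : decode (N.lxor m n) = decode m + decode n.
Proof.
rewrite /decode !big_filter !(big_mkcond (fun i => N.testbit _ _)) -big_split.
apply: eq_bigr => i _; rewrite N.lxor_spec.
by do 2!case: N.testbit; rewrite /= ?addr0 ?add0r ?F2_addrr.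
Qed.

Lemma decode0 : decode 0%num = 0.
Proof. exact: big_nil. Qed.

Lemma decode_unit_code (i : nat) : (i < 8)%N ->
  decode (unit_code i) = groupRing_elt 'F_2 (quat i).
Proof. by do 8![case: i => [_|i]; first exact: big_seq1]. Qed.

Lemma decode_foldr (l : seq N) :
  decode (foldr N.lxor 0%num l) = \sum_(n <- l) decode n.
Proof.
by elim: l => [|n l IHl]; rewrite ?big_nil ?big_cons ?decode0 //= decodeD IHl.
Qed.

Lemma bits_lt8 (n : N) (i : nat) : i \in bits n -> (i < 8)%N.
Proof. by rewrite mem_filter mem_iota => /andP[_]. Qed.

Lemma decodeM (m n : N) : decode (code_mul m n) = decode m * decode n.
Proof.
rewrite /code_mul decode_foldr big_allpairs_dep /= mulr_suml.
rewrite big_seq [RHS]big_seq; apply: eq_bigr => i /bits_lt8 i8.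
rewrite mulr_sumr big_seq [RHS]big_seq; apply: eq_bigr => j /bits_lt8 j8.
by rewrite decode_unit_code ?index_mul_lt // groupRing_eltM quatM.
Qed.

Lemma decode1 : decode 1%num = 1.
Proof.
by rewrite (@decode_unit_code 0) // /quat expg0 mulg1.
Qed.

Lemma decodeX (n : N) (k : nat) :
  decode (iter k (code_mul n) 1%num) = decode n ^+ k.
Proof.
by elim: k => [|k IHk]; rewrite ?expr0 ?decode1 //= decodeM IHk exprS.
Qed.

(** The set bits name distinct group elements, so their sum vanishes only when there are none. This
    makes the base case of [in_span] exact. *)
Lemma decode_eq0 (n : N) : (decode n == 0) = nilp (bits n).
Proof.
apply/eqP/nilP => [n0|]; last by rewrite /decode => ->; rewrite big_nil.
apply/eqP/negPn; rewrite -has_filter; apply/hasPn => i; rewrite mem_iota => i8.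
have /eqP := decode_quat n i8; rewrite n0 ffunE.
by case: N.testbit.
Qed.

Lemma mem_span_decode (s : seq N) (n : N) :
  (decode n \in <<map decode s>>%VS) = in_span s n.
Proof.
elim: s n => [|v s IHs] n; first by rewrite span_nil memv0 decode_eq0.
by rewrite /= F2_mem_span_cons -decodeD !IHs; case: in_span.
Qed.

Lemma free_decode (s : seq N) : free (map decode s) = independent s.
Proof.
by elim: s => [|v s IHs]; rewrite ?nil_free //= free_cons mem_span_decode IHs.
Qed.

Lemma delete_dependent_decode (s : seq N) :
  delete_dependent (map decode s) = map decode (prune s).
Proof.
elim/last_ind: s => [//|s n IHs].
rewrite map_rcons /delete_dependent /prune !foldl_rcons.
rewrite -/(delete_dependent _) -/(prune s) IHs mem_span_decode.
by case: in_span; rewrite ?map_rcons.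
Qed.

Lemma combine_bases_decode (s t : seq N) :
  combine_bases (map decode s) (map decode t) = map decode (prune (s ++ t)).
Proof. by rewrite /combine_bases -map_cat delete_dependent_decode. Qed.

Lemma span_prune (s : seq N) :
  <<map decode (prune s)>>%VS = <<map decode s>>%VS.
Proof. by rewrite -delete_dependent_decode span_delete_dependent. Qed.

Lemma code_subspan_decode (s t : seq N) :
  (<<map decode s>> <= <<map decode t>>)%VS = code_subspan s t.
Proof.
rewrite /code_subspan -(span_prune t); apply/span_subvP/allP => st.
  by move=> n ns; rewrite -mem_span_decode st // map_f.
by move=> _ /mapP[n ns ->]; rewrite mem_span_decode st.
Qed.

(** * Spans of codes as ideals *)

Definition code_ideal (s : seq N) : {set R} := spanned (map decode s).

Lemma mem_code_ideal (s : seq N) (n : N) :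
  (decode n \in code_ideal s) = in_span s n.
Proof. by rewrite spannedE mem_span_decode. Qed.

Lemma subset_code_ideal (s t : seq N) :
  (code_ideal s \subset code_ideal t) = code_subspan s t.
Proof. by rewrite subset_spanned code_subspan_decode. Qed.

Lemma eq_code_ideal (s t : seq N) :
  (code_ideal s == code_ideal t) = code_subspan s t && code_subspan t s.
Proof. by rewrite eqEsubset !subset_code_ideal. Qed.

Lemma code_ideal_nil : code_ideal [::] = [set 0].
Proof. by apply/setP => x; rewrite spannedE span_nil memv0 inE. Qed.

Lemma code_ideal_full : code_ideal unit_codes = setT.
Proof.
apply/setP => x; rewrite spannedE inE.
have -> : x = \sum_g (x g : 'F_2) *: groupRing_elt 'F_2 g.
  apply/ffunP => h; rewrite sum_ffunE (bigD1 h) //= big1 => [|g /negPf gh].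
    by rewrite [RHS]addr0 !ffunE eqxx; exact/esym/mulr1.
  by rewrite !ffunE eq_sym gh; exact: mulr0.
apply: memv_suml => g _; apply: memvZ; apply: memv_span.
have [i i8 ->] := quat_onto g.
by rewrite -decode_unit_code // map_f // map_f // mem_iota.
Qed.

Lemma span_elementsP (s : seq N) (x : R) : x \in <<map decode s>>%VS ->
  exists2 n, n \in span_elements s & x = decode n.
Proof.
elim: s x => [|v s IHs] x /=.
  by rewrite span_nil memv0 => /eqP->; exists 0%num; rewrite ?decode0.
rewrite F2_mem_span_cons => /orP[] /IHs[n ns Dn].
  by exists n; rewrite // mem_cat ns.
exists (N.lxor v n); first by rewrite mem_cat map_f ?orbT.
by rewrite decodeD -Dn addrA F2_addrr add0r.
Qed.

Lemma decode_onto (x : R) :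
  exists2 n, n \in span_elements unit_codes & x = decode n.
Proof.
by apply: span_elementsP; rewrite -spannedE [spanned _]code_ideal_full inE.
Qed.

Lemma code_ideal_two_sided (s : seq N) :
  span_closed s -> two_sided_ideal (code_ideal s).
Proof.
move=> /allP sP.
have sX i v : (i < 8)%N -> v \in s ->
    in_span (prune s) (code_mul (unit_code i) v) /\
    in_span (prune s) (code_mul v (unit_code i)).
  move=> i8 vs; apply/andP; apply: (allP (sP v vs)).
  by rewrite mem_iota.
split.
- by rewrite spannedE mem0v.
- by move=> x y; rewrite !spannedE; apply: rpredB.
- move=> x xs r; have [n _ ->] := decode_onto r.
  move: x xs => x; rewrite !spannedE; move: x.
  apply: F2_span_ind => [|x y ? ?|_ /mapP[v vs ->]].
    by rewrite mulr0 mem0v.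
    by rewrite mulrDr rpredD.
  (* The multiplier [r] expands into group elements, which reduces the claim to the products checked
     by [span_closed]. *)
  rewrite mulr_suml big_seq; apply: memv_suml => i /bits_lt8 i8.
  rewrite -decode_unit_code // -decodeM -span_prune mem_span_decode.
  by case: (sX i v).
move=> x xs r; have [n _ ->] := decode_onto r.
move: x xs; rewrite /code_ideal => x; rewrite !spannedE; move: x.
apply: F2_span_ind => [|x y ? ?|_ /mapP[v vs ->]].
  by rewrite mul0r mem0v.
  by rewrite mulrDl rpredD.
rewrite mulr_sumr big_seq; apply: memv_suml => i /bits_lt8 i8.
rewrite -decode_unit_code // -decodeM -span_prune mem_span_decode.
by case: (sX i v).
Qed.

(** * The ideals I(H) and the cyclic subgroups *)

Lemma relative_augmentation_code (l : seq nat) :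
    {in l, forall i, (i < 8)%N} ->
  relative_augmentation 'F_2 [set:: map quat l]
    = code_ideal (augmentation_codes l).
Proof.
move=> l8; set H := [set:: _].
have elt_sub1 i : (i < 8)%N ->
    groupRing_elt 'F_2 (quat i) - 1 = decode (N.lxor (unit_code i) 1).
  by move=> i8; rewrite decodeD decode1 decode_unit_code // F2_oppr.
apply/setP => z; rewrite spannedE; apply/imsetP/idP => [[x _ ->]|].
  apply: memv_suml => h; rewrite inE => /mapP[i il ->].
  have [n _ ->] := decode_onto (x (quat i)).
  rewrite elt_sub1 ?l8 // mulr_suml big_seq; apply: memv_suml => j /bits_lt8 j8.
  rewrite -decode_unit_code // -decodeM memv_span // map_f //.
  by apply: allpairs_f => //; apply: map_f; rewrite mem_iota.
(* Conversely, coefficient families add pointwise, and the generator u(h - e) comes from the family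
   with value u at h and 0 elsewhere. *)
move: z; apply: F2_span_ind.
- exists [ffun=> 0] => //; rewrite big1 // => h _; rewrite ffunE; exact: mul0r.
- move=> _ _ [x _ ->] [y _ ->]; exists [ffun h => x h + y h] => //.
  rewrite -big_split /=; apply: eq_bigr => h _.
  by rewrite [[ffun _ => _] h]ffunE mulrDl.
move=> _ /mapP[_ /allpairsP[[i u] /= [il us ->]] ->].
exists [ffun h => if h == quat i then decode u else 0] => //.
rewrite (bigD1 (quat i)) ?inE ?map_f //= big1 => [|h /andP[_ /negPf hi]].
  by rewrite addr0 ffunE eqxx elt_sub1 ?l8 // decodeM.
by rewrite ffunE hi mul0r.
Qed.

Lemma quatX (i k : nat) : (i < 8)%N ->
  (quat i ^+ k)%g = quat (iter k (index_mul i) 0).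
Proof.
move=> i8; suff [] : (iter k (index_mul i) 0 < 8)%N /\
  (quat i ^+ k)%g = quat (iter k (index_mul i) 0) by [].
elim: k => [|k [k8 IHk]]; first by rewrite expg0 /quat !expg0 mulg1.
by rewrite expgS IHk iterS quatM // index_mul_lt.
Qed.

(** Every element satisfies x^4 = 1, so four powers exhaust the cycle; they repeat when the order is
    smaller, as for a^2. *)
Lemma cycle_quat (i : nat) : (i < 8)%N ->
  <[quat i]>%g = [set:: [seq quat (iter k (index_mul i) 0) | k <- iota 0 4]].
Proof.
move=> i8; have i4 : (quat i ^+ 4 = 1)%g.
  have -> : 1%g = quat 0 by rewrite /quat !expg0 mulg1.
  by rewrite quatX //; congr quat; move: i i8; do 8![case=> [//|]].
apply/setP => x; rewrite inE; apply/cycleP/mapP => [[k ->]|[k _ ->]].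
  by exists (k %% 4)%N; rewrite ?mem_iota ?ltn_pmod // -quatX // expg_mod.
by exists k; rewrite quatX.
Qed.

(** * Classification of the two-sided ideals *)

Lemma two_sided_ideal_code (J : {set R}) : two_sided_ideal J ->
  exists2 s, s \in all_codes & J = code_ideal s.
Proof.
move=> idJ; have [J0 _ _ JM] := idJ.
(* Invariant of the induction over the elements of [J]: some entry of the list spans a subset of [J]
   containing all elements met so far. *)
suff [s ss /andP[sJ Js]] : exists2 s, s \in all_codes &
    (code_ideal s \subset J) && all (fun x => x \in code_ideal s) (enum J).
  exists s => //; apply/eqP; rewrite eqEsubset sJ andbT.
  by apply/subsetP => x xJ; apply: (allP Js); rewrite mem_enum.
have: {subset enum J <= J} by move=> x; rewrite mem_enum.
elim: (enum J) => [|x l IHl] lJ.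
  by exists [::] => //; rewrite code_ideal_nil sub1set J0.
case: IHl => [y yl|s ss /andP[sJ /allP ls]]; first by rewrite lJ // inE yl orbT.
have [n n8 Dx] := decode_onto x.
have /hasP[t tt] := allP all_codes_principal n n8.
case: ifP => // nt; rewrite -subset_code_ideal => tn.
(* [t] spans a subset of xR, which stays in [J] by right multiplication. *)
have tJ : code_ideal t \subset J.
  apply: subset_trans tn _; apply: F2_spanned_subset_ideal => //.
  move=> _ /mapP[_ /mapP[u _ ->] ->]; rewrite decodeM -Dx.
  by apply: JM; apply: lJ; rewrite mem_head.
(* The entry [u] for the sum of [s] and [t] carries the invariant on to [x :: l]. *)
have /hasP[u uu] := allP (allP all_codes_add s ss) t tt.
case: ifP => //; rewrite -!subset_code_ideal => /andP[su tu] ust.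
exists u => //; apply/andP; split.
  apply: subset_trans ust _; apply: F2_spanned_subset_ideal => // y.
  rewrite map_cat mem_cat => /orP[ys|yt].
    by apply: (subsetP sJ); rewrite spannedE memv_span.
  by apply: (subsetP tJ); rewrite spannedE memv_span.
rewrite /= Dx (subsetP tu) ?mem_code_ideal //=.
by apply/allP => y yl; rewrite (subsetP su) ?ls.
Qed.

Lemma nontrivial_ideal_code (J : {set R}) :
  nontrivial_ideal J <-> J \in map code_ideal proper_codes.
Proof.
split=> [[/two_sided_ideal_code[s]]|/mapP[s ss ->]].
  (* The first two entries of [all_codes] span 0 and R, which nontriviality excludes. *)
  rewrite 2!in_cons => /or3P[/eqP->|/eqP->|ss] -> => [/eqP|_ /eqP|_ _].
  - by rewrite code_ideal_nil.
  - by rewrite code_ideal_full.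
  by rewrite map_f.
have /andP[s0 s1] := allP proper_codes_proper s ss.
split; first exact: code_ideal_two_sided (allP proper_codes_closed s ss).
  by rewrite -code_ideal_nil eqEsubset !subset_code_ideal (negPf s0).
by rewrite -code_ideal_full eqEsubset !subset_code_ideal (negPf s1) andbF.
Qed.

Lemma code_ideal_basis (s : seq N) (I : {set R}) :
  I = code_ideal s -> independent s && span_closed s ->
  ideal_basis (map decode s) I.
Proof.
move=> -> /andP[s_free s_closed]; split=> //; first by rewrite free_decode.
exact: code_ideal_two_sided.
Qed.

End Quaternion.

(** * The named ideals in coordinates *)

Theorem mainTheorem3 (G : finGroupType) (ga gb : G)
    (hQ : quaternion_generators ga gb) :
  let R := groupRing 'F_2 G in
  let e : R := 1 in
  let a : R := groupRing_elt 'F_2 ga in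
  let b : R := groupRing_elt 'F_2 gb in
  let ab : R := a * b in
  let ba : R := b * a in
  let I_ (H : {set G}) : {set R} := relative_augmentation 'F_2 H in
  let subgroups : seq {set G} :=
    [:: [set: G]; <[ga]>; <[gb]>; <[ga * gb]>; <[ga ^+ 2]>]%g in
  let S : R :=
    e + a + a ^+ 2 + a ^+ 3 + b + a * b + a ^+ 2 * b + a ^+ 3 * b in
  let N : {set R} := [set 0; S] in
  let Ia : {set R} :=
    [set l1 *: (e + a) ^+ 3 + l2 *: ((e + a) ^+ 3 * b)
       | l1 : 'F_2, l2 : 'F_2] in
  let Ib : {set R} :=
    [set l1 *: (e + b) ^+ 3 + l2 *: ((e + b) ^+ 3 * a)
       | l1 : 'F_2, l2 : 'F_2] in
  let Iab : {set R} :=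
    [set l1 *: (e + ab) ^+ 3 + l2 *: ((e + ab) ^+ 3 * a)
       | l1 : 'F_2, l2 : 'F_2] in
  let Ia_basis : seq R := [:: (e + a) ^+ 3; (e + a) ^+ 3 * b] in
  let Ib_basis : seq R := [:: (e + b) ^+ 3; (e + b) ^+ 3 * a] in
  let Iab_basis : seq R := [:: (e + ab) ^+ 3; (e + ab) ^+ 3 * a] in
  let Ia_b : {set R} := spanned (combine_bases Ia_basis Ib_basis) in
  let Ia_ab : {set R} := spanned (combine_bases Ia_basis Iab_basis) in
  let Ib_ab : {set R} := spanned (combine_bases Ib_basis Iab_basis) in
  let Ma_basis : seq R :=
    [:: (e + a) * (e + a); (e + a) ^+ 2 * a;
        (e + b) ^+ 2 * b; (e + b) ^+ 2 * ab] in
  let Mb_basis : seq R :=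
    [:: (e + a) * (e + b); (e + a) * (e + b) * a;
        (e + a) * (e + b) * b; (e + a) * (e + b) * ab] in
  (* The last element is (e + a)(e + ab)ba, not (e + a)(e + ab)ab: since
     (e + a)(e + ab)(e + a + b + ab) = 0, the list with ab is not free. *)
  let Mab_basis : seq R :=
    [:: (e + a) * (e + ab); (e + a) * (e + ab) * a;
        (e + a) * (e + ab) * b; (e + a) * (e + ab) * ba] in
  let Ma : {set R} := spanned Ma_basis in
  let Mb : {set R} := spanned Mb_basis in
  let Mab : {set R} := spanned Mab_basis in
  let Ma_b : {set R} := spanned (combine_bases Ma_basis Mb_basis) in
  let Ma_ab : {set R} := spanned (combine_bases Ma_basis Mab_basis) in
  let Mb_ab : {set R} := spanned (combine_bases Mb_basis Mab_basis) in
  [/\ forall H : {set G}, H \in subgroups -> two_sided_ideal (I_ H),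
      [/\ two_sided_ideal N, #|N| = 2%N
        & forall J : {set R},
            two_sided_ideal J -> J != [set 0] -> N \subset J],
      [/\ [/\ ideal_basis Ia_basis Ia, ideal_basis Ib_basis Ib
            & ideal_basis Iab_basis Iab],
          combine_bases Ia_basis Ib_basis =
            [:: (e + a) ^+ 3; (e + a) ^+ 3 * b; (e + b) ^+ 3],
          ideal_basis [:: (e + a) ^+ 3; (e + a) ^+ 3 * b; (e + b) ^+ 3] Ia_b,
          (Ia \subset Ia_b) && (Ib \subset Ia_b)
        & Ia_b = Ia_ab /\ Ia_b = Ib_ab],
      [/\ [/\ ideal_basis Ma_basis Ma, ideal_basis Mb_basis Mb
            & ideal_basis Mab_basis Mab],
          [/\ Ia_b \subset Ma, Ia_b \subset Mb & Ia_b \subset Mab],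
          (* Mab is the ideal generated by the list with ab in place of ba *)
          (forall J : {set R}, two_sided_ideal J ->
             {subset [:: (e + a) * (e + ab); (e + a) * (e + ab) * a;
                         (e + a) * (e + ab) * b; (e + a) * (e + ab) * ab]
                <= J} <-> Mab \subset J),
          combine_bases Ma_basis Mb_basis =
            [:: (e + a) ^+ 2; (e + a) ^+ 2 * a; (e + b) ^+ 2 * b;
                (e + b) ^+ 2 * ab; (e + a) * (e + b)] /\
          ideal_basis
            [:: (e + a) ^+ 2; (e + a) ^+ 2 * a; (e + b) ^+ 2 * b;
                (e + b) ^+ 2 * ab; (e + a) * (e + b)] Ma_b
        & Ma_b = Ma_ab /\ Ma_b = Mb_ab]
    & forall J : {set R},
        nontrivial_ideal J <->
        J \in map I_ subgroups ++
              [:: N; Ia; Ib; Iab; Ia_b; Ma; Mb; Mab; Ma_b]].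
Proof.
move=> R e a b ab ba I_ subgroups S N Ia Ib Iab Ia_basis Ib_basis Iab_basis.
move=> Ia_b Ia_ab Ib_ab Ma_basis Mb_basis Mab_basis Ma Mb Mab Ma_b Ma_ab Mb_ab.
have g1 : ga = quat ga gb 1 by rewrite /quat expg0 mulg1.
have g4 : gb = quat ga gb 4 by rewrite /quat expg0 mul1g.
have De : e = decode ga gb 1%num by rewrite decode1.
have Da : a = decode ga gb 2%num by rewrite (@decode_unit_code _ _ _ 1) // -g1.
have Db : b = decode ga gb 16%num by rewrite (@decode_unit_code _ _ _ 4) // -g4.
(* Rewriting backwards with these gathers each ring expression into one [decode] of a closed code,
   and conversion evaluates that code. *)
pose decE := (decodeD, decodeX hQ, decodeM hQ).
have EA : Ia_basis = map (decode ga gb) [:: 15; 240]%num.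
  by rewrite /Ia_basis De Da Db -!decE.
have EB : Ib_basis = map (decode ga gb) [:: 85; 170]%num.
  by rewrite /Ib_basis De Da Db -!decE.
have EAB : Iab_basis = map (decode ga gb) [:: 165; 90]%num.
  by rewrite /Iab_basis /ab De Da Db -!decE.
(* Since (e+a)^2 = (e+b)^2 = e + a^2, these are also the codes of I(H) for H generated by a^2. *)
have FA : Ma_basis = map (decode ga gb) [:: 5; 10; 80; 160]%num.
  by rewrite /Ma_basis /ab De Da Db -!decE.
have FB : Mb_basis = map (decode ga gb) [:: 51; 150; 60; 102]%num.
  by rewrite /Mb_basis /ab De Da Db -!decE.
have FAB : Mab_basis = map (decode ga gb) [:: 99; 54; 57; 147]%num.
  by rewrite /Mab_basis /ab /ba De Da Db -!decE.
have EI3 : [:: (e + a) ^+ 3; (e + a) ^+ 3 * b; (e + b) ^+ 3]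
    = map (decode ga gb) [:: 15; 240; 85]%num.
  by rewrite De Da Db -!decE.
have EM5 : [:: (e + a) ^+ 2; (e + a) ^+ 2 * a; (e + b) ^+ 2 * b;
               (e + b) ^+ 2 * ab; (e + a) * (e + b)]
    = map (decode ga gb) [:: 5; 10; 80; 160; 51]%num.
  by rewrite /ab De Da Db -!decE.
have EQ : [:: (e + a) * (e + ab); (e + a) * (e + ab) * a;
              (e + a) * (e + ab) * b; (e + a) * (e + ab) * ab]
    = map (decode ga gb) [:: 99; 54; 57; 108]%num.
  by rewrite /ab De Da Db -!decE.
have ES : S = decode ga gb 255%num by rewrite /S De Da Db -!decE.
have SN : N = code_ideal ga gb [:: 255]%num.
  by rewrite /N -F2_spanned1 ES.
have SIa : Ia = code_ideal ga gb [:: 15; 240]%num.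
  by rewrite /code_ideal -EA; exact: F2_spanned2.
have SIb : Ib = code_ideal ga gb [:: 85; 170]%num.
  by rewrite /code_ideal -EB; exact: F2_spanned2.
have SIab : Iab = code_ideal ga gb [:: 165; 90]%num.
  by rewrite /code_ideal -EAB; exact: F2_spanned2.
(* The scan drops 170 = 15 xor 240 xor 85. *)
have CI : combine_bases Ia_basis Ib_basis
    = map (decode ga gb) [:: 15; 240; 85]%num.
  by rewrite EA EB combine_bases_decode.
(* Adding 51 to each of 150, 60 and 102 gives 5 xor 160, 5 xor 10 and 5 xor 80, so all three are
   dropped. *)
have CM : combine_bases Ma_basis Mb_basis
    = map (decode ga gb) [:: 5; 10; 80; 160; 51]%num.
  by rewrite FA FB combine_bases_decode.
have SIa_b : Ia_b = code_ideal ga gb [:: 15; 240; 85]%num by rewrite /Ia_b CI.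
have SMa : Ma = code_ideal ga gb [:: 5; 10; 80; 160]%num by rewrite /Ma FA.
have SMb : Mb = code_ideal ga gb [:: 51; 150; 60; 102]%num by rewrite /Mb FB.
have SMab : Mab = code_ideal ga gb [:: 99; 54; 57; 147]%num by rewrite /Mab FAB.
have SMa_b : Ma_b = code_ideal ga gb [:: 5; 10; 80; 160; 51]%num.
  by rewrite /Ma_b CM.
have SI : map I_ subgroups = map (code_ideal ga gb) (take 5 proper_codes).
  have aug H l s : H = [set:: map (quat ga gb) l] -> all (gtn 8) l ->
      code_subspan (augmentation_codes l) s
        && code_subspan s (augmentation_codes l) ->
    I_ H = code_ideal ga gb s.
    move=> -> /allP l8 ls; apply/eqP.
    by rewrite /I_ relative_augmentation_code // eq_code_ideal.
  have cyc i x s (l := map (fun k => iter k (index_mul i) 0%N) (iota 0 4)) :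
      x = quat ga gb i -> (i < 8)%N && all (gtn 8) l ->
      code_subspan (augmentation_codes l) s
        && code_subspan s (augmentation_codes l) ->
    I_ <[x]>%g = code_ideal ga gb s.
    move=> -> /andP[i8 l8]; apply: aug => //.
    by rewrite (cycle_quat hQ) // -map_comp.
  rewrite /subgroups /=; congr [:: _; _; _; _; _].
  - apply: (aug _ (iota 0 8)) => //; apply/setP => x; rewrite in_setT [RHS]inE.
    have [i i8 ->] := quat_onto hQ x.
    by rewrite map_f ?mem_iota.
  (* The indices 1, 4, 5, 2 stand for a, b, ab, a^2. *)
  - exact: (cyc 1).
  - exact: (cyc 4).
  - by apply: (cyc 5) => //; rewrite /quat !expg1.
  by apply: (cyc 2) => //; rewrite /quat expg0 mulg1.
have S_all : map I_ subgroups ++ [:: N; Ia; Ib; Iab; Ia_b; Ma; Mb; Mab; Ma_b]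
    = map (code_ideal ga gb) proper_codes.
  rewrite SI SN SIa SIb SIab SIa_b SMa SMb SMab SMa_b.
  rewrite -[[:: _; _; _; _; _; _; _; _; _]]
    /(map (code_ideal ga gb) (drop 5 proper_codes)).
  by rewrite -map_cat cat_take_drop.
split.
- move=> H HS; have : I_ H \in map I_ subgroups by apply/mapP; exists H.
  rewrite SI => /mapP[s /mem_take ss ->].
  exact: code_ideal_two_sided (allP proper_codes_closed s ss).
- split.
  + by rewrite SN; apply: code_ideal_two_sided.
  + by rewrite /N cards2 eq_sym ES decode_eq0.
  move=> J /(two_sided_ideal_code hQ)[s ss ->].
  have /orP[/nilP->|sN] := allP all_codes_sum s ss.
    by rewrite code_ideal_nil eqxx.
  by rewrite SN subset_code_ideal.
- split.
  + by split; rewrite ?EA ?EB ?EAB; apply: code_ideal_basis.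
  + by rewrite CI EI3.
  + by rewrite EI3; apply: code_ideal_basis.
  + by rewrite SIa SIb SIa_b !subset_code_ideal.
  rewrite SIa_b /Ia_ab /Ib_ab EA EB EAB !combine_bases_decode //.
  by split; apply/eqP; rewrite eq_code_ideal.
- split.
  + by split; rewrite ?FA ?FB ?FAB; apply: code_ideal_basis.
  + by rewrite SMa SMb SMab SIa_b !subset_code_ideal.
  (* The first element (e+a)(e+ab) alone yields the basis of [Mab] by right multiplication by a, b
     and ba; conversely the four codes of [EQ] are tested for membership in [Mab]. *)
  + move=> J idJ; have [_ _ _ JM] := idJ; split=> [sJ|/subsetP MJ x].
      have QJ : (e + a) * (e + ab) \in J by apply: sJ; rewrite mem_head.
      apply: (F2_spanned_subset_ideal idJ) => x.
      by rewrite !inE => /or4P[] /eqP->; [exact: QJ | exact: JM..].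
    rewrite EQ => /mapP[n ns ->]; apply: MJ; rewrite SMab mem_code_ideal //.
    by move: n ns; apply/allP.
  + by rewrite CM EM5; split=> //; apply: code_ideal_basis.
  rewrite SMa_b /Ma_ab /Mb_ab FA FB FAB !combine_bases_decode //.
  by split; apply/eqP; rewrite eq_code_ideal.
by move=> J; rewrite S_all; apply: nontrivial_ideal_code.
Qed.
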